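(* Let $\pi$ be a continuous piecewise linear minimal valid function for $R_f(\mathbb{R},\mathbb{Z})$ with set $B$ of rational breakpoints with least common denominator $q$. Let $\hat G=\frac{1}{4q}\mathbb{Z}$. Then $\pi$ is extreme for $R_f(\mathbb{R},\mathbb{Z})$ if and only if the restriction $\pi|_{\hat G}$ is extreme for $R_f(\hat G,\mathbb{Z})$.
   Context: For an abelian group $G$ written additively (here a subgroup of $\mathbb{R}$ containing $\mathbb{Z}$), a subgroup $S$ of $G$, and $f\in G$, $R_f(G,S)$ is the convex hull of the set of all functions $s\colon G\to\mathbb{Z}_+$ of finite support with $\sum_{r\in G} r\,s(r)\in f+S$ (in the vector space of finitely supported functions $G\to\mathbb{R}$). A valid function for $R_f(G,S)$ is a function $\pi\colon G\to\mathbb{R}$ with $\pi\ge 0$ and $\sum_{r\in G}\pi(r)s(r)\ge 1$ for all $s\in R_f(G,S)$. A valid function $\pi$ is minimal if there is no valid function $\pi'\ne\pi$ with $\pi'\le\pi$ pointwise. A valid function $\pi$ is extreme for $R_f(G,S)$ if $\pi=\frac12(\pi^1+\pi^2)$ with $\pi^1,\pi^2$ valid functions for $R_f(G,S)$ implies $\pi=\pi^1=\pi^2$. Piecewise linear: let $0=x_0<x_1<\dots<x_n=1$ and let $B=\{x_i+t: 0\le i\le n-1,\ t\in\mathbb{Z}\}$ be the set of breakpoints. A function $\pi\colon\mathbb{R}\to\mathbb{R}_+$, periodic modulo $\mathbb{Z}$, is piecewise linear with breakpoints in $B$ if on each open interval between consecutive elements of $B$ it agrees with an affine function. (For a minimal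 piecewise linear $\pi$ with breakpoints in $B$ one always has $f\in B$, so $f\in\hat G$ and $R_f(\hat G,\mathbb{Z})$ makes sense.) *)

(* Defs.v *)
From HB Require Import structures.
From mathcomp Require Import all_boot all_order all_algebra.
From mathcomp Require Import all_classical all_reals all_analysis.

Set Implicit Arguments.
Unset Strict Implicit.
Unset Printing Implicit Defensive.

Import Order.TTheory GRing.Theory Num.Theory.
Import numFieldNormedType.Exports.

Local Open Scope classical_set_scope.
Local Open Scope ring_scope.

Section InfiniteGroupProblem.
Variables (R : realType) (G : zmodType) (S : set G) (f : G).
Implicit Types pi : G -> R.

Definition integer_solutions : set (G -> nat) :=
  [set s | finite_set [set r | s r <> 0%N] /\
           exists2 t, S t & \sum_(r \in [set: G]) r *+ s r = f + t].

(* R_f(G,S). The hull is taken among all functions G -> R; it only contains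
   functions of finite support, as these form a linear subspace. *)
Definition group_relaxation : set (G -> R) :=
  smallest (fun A : set (convex_lmodType (G -> R^o)) => convex_set A)
    [set (fun r => (s r)%:R) | s in integer_solutions].

Definition valid_function pi : Prop :=
  (forall r, 0 <= pi r) /\
  (forall s, group_relaxation s -> 1 <= \sum_(r \in [set: G]) pi r * s r).

Definition minimal_valid pi : Prop :=
  valid_function pi /\
  ~ (exists pi', [/\ valid_function pi', pi' <> pi & forall r, pi' r <= pi r]).

Definition extreme pi : Prop :=
  valid_function pi /\
  forall pi1 pi2, valid_function pi1 -> valid_function pi2 ->
    pi = (fun r => 2^-1 * (pi1 r + pi2 r)) -> pi = pi1 /\ pi = pi2.

End InfiniteGroupProblem.

Definition subdivision01 (F : numDomainType) n (x : 'I_n.+1 -> F) : Prop :=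
  [/\ x ord0 = 0, x ord_max = 1 & {homo x : i j / (i < j)%N >-> i < j}].

Definition breakpoints (R : realType) n (x : 'I_n.+1 -> R) : set R :=
  [set y | exists i : 'I_n.+1, exists t : int, (i < n)%N /\ y = x i + t%:~R].

Definition piecewise_linear (R : realType) (B : set R) (pi : R -> R) : Prop :=
  [/\ forall y, 0 <= pi y,
      periodic pi 1 &
      forall a b, B a -> B b -> a < b ->
        (forall c, B c -> ~ (a < c < b)) ->
        exists m k : R, forall y, a < y < b -> pi y = m * y + k].

Definition least_common_denominator n (x : 'I_n.+1 -> rat) : nat :=
  \big[lcmn/1%N]_(i < n.+1) `|denq (x i)|%N.

Section FractionGroup.
Variables (R : realType) (N : nat).

Definition fracZ_pred : {pred R} :=
  [pred y | `[< exists k : int, y = k%:~R / N%:R >]].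

Fact fracZ_zmod_closed : zmod_closed fracZ_pred.
Proof.
split; first by apply/asboolP; exists 0; rewrite mul0r.
move=> _ _ /asboolP[k ->] /asboolP[l ->]; apply/asboolP; exists (k - l).
by rewrite rmorphB mulrBl.
Qed.

HB.instance Definition _ :=
  GRing.isZmodClosed.Build R fracZ_pred fracZ_zmod_closed.

(* The additive group (1/N)Z, as a subgroup of R. *)
Record fracZ : Type := FracZ { fracZ_val :> R; _ : fracZ_val \in fracZ_pred }.

HB.instance Definition _ := [isSub for fracZ_val].
HB.instance Definition _ := [Choice of fracZ by <:].
HB.instance Definition _ := [SubChoice_isSubZmodule of fracZ by <:].

End FractionGroup.

Definition integers (R : realType) : set R := range (fun k : int => k%:~R).

Definition integers_in_fracZ (R : realType) N : set (fracZ R N) :=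
  [set r | integers (fracZ_val r)].

(* Main.v *)
Require Import Defs.
From mathcomp Require Import all_boot all_order all_algebra.
From mathcomp Require Import all_classical all_reals all_analysis.
From mathcomp Require Import zify ring lra.

(** Minimal valid functions are the nonnegative functions that vanish on S, are
    subadditive and satisfy the symmetry pi r + pi (f - r) = 1
    ([minimal_gj], [gj_minimal]); if such a function is an average of two valid
    functions, both of these are again minimal ([average_gj]).  Extremality
    thus only concerns functions satisfying these four conditions.  The
    function pi is affine between consecutive points of (1/q)Z, and f lies in
    (1/q)Z ([gj_target_on_grid]): otherwise pi would equal 1 on the whole grid
    cell around f, hence by symmetry vanish at 0, 1/q and -1/q, and then, by
    subadditivity, on all of (1/q)Z, including the end points of that cell.

    If pi is extreme, so is its restriction to (1/4q)Z: a decomposition of the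
    restriction interpolates linearly to one of pi.  Interpolation preserves
    subadditivity because the defect pi x + pi y - pi (x + y) of a function
    that is affine on the cells is affine on each of the triangles cut out by
    the lines x, y, x + y in the grid, and so is a convex combination of its
    values at the vertices ([defect_triangle]).

    Conversely, let pi be the average of pi1 and pi2 with pi1 different from
    pi, and put Phi = pi1 - pi.  Then Phi is bounded, and Phi x + Phi y =
    Phi (x + y) whenever pi x + pi y = pi (x + y).  If Phi does not vanish on
    (1/4q)Z, the restriction of pi is visibly not extreme.  Otherwise call a
    cell of (1/q)Z live when Phi is not identically zero on it, and let the
    zigzag take the values 0, 1, 0, -1 at the four successive points of
    (1/4q)Z in each live cell, and 0 elsewhere.  The zigzag is additive
    wherever pi is additive on (1/4q)Z ([zigzag_additive]), because the defect
    of pi, being nonnegative and affine on a triangle, vanishes on the whole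
    face whose relative interior contains a zero:
    - inside a triangle, Phi becomes a bounded additive function vanishing at
      the ends of the three cells involved, so it is zero there
      ([bounded_additive_eq0]) and none of these cells is live;
    - on a horizontal or vertical edge, Phi on one cell is a translate of Phi
      on another, and both cells are live or neither is;
    - on a diagonal edge, Phi on one cell is minus the reflection of Phi on
      another; again both are live or neither is, and the zigzag is odd under
      reflection of a cell.  Oddness forces the value 0 at the
      midpoint of the cell, which is why the cells are cut into four parts.
    On (1/4q)Z modulo Z there are only finitely many inequalities to preserve,
    so adding a small multiple of the zigzag, or subtracting it, keeps all
    conditions ([perturbation_gj]), and the restriction of pi is the average
    of the two perturbed functions. *)

Set Implicit Arguments.
Unset Strict Implicit.
Unset Printing Implicit Defensive.

Import Order.TTheory GRing.Theory Num.Theory.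
Import numFieldNormedType.Exports.

Local Open Scope classical_set_scope.
Local Open Scope ring_scope.

(** * Validity and minimality *)

Section ValidFunctions.
Context {R : realType} {G : zmodType}.
Variables (S : set G) (f : G).
Implicit Types (pi : G -> R) (l : seq G).

(** Finitely supported functions to the natural numbers are handled as
    sequences up to permutation, for which moving or splitting copies of an
    element is a filter or a flatten. *)
Definition multiplicity l (r : G) : nat := count_mem r l.

Lemma fsum_multiplicity (V : nmodType) (h : G -> V) l :
  \sum_(r \in [set: G]) h r *+ multiplicity l r = \sum_(r <- l) h r.
Proof.
rewrite (fsbigE (undup l)) ?undup_uniq //; last first.
  move=> i _; rewrite mem_undup => il.
  by rewrite /multiplicity (count_memPn il).
rewrite big_mkcond -[RHS]big_undup_iterop_count; apply: eq_bigr => r _.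
rewrite in_setT /multiplicity Monoid.iteropE.
by elim: (count_mem r l) => //= n <-; rewrite mulrS.
Qed.

Lemma finite_multiplicity l : finite_set [set r | multiplicity l r <> 0%N].
Proof.
apply: (@sub_finite_set _ _ [set` l]); last exact: finite_seq.
by move=> r /= /eqP; rewrite -lt0n -has_count has_pred1.
Qed.

Lemma finite_support_multiplicity (s : G -> nat) :
  finite_set [set r | s r <> 0%N] -> exists l, s = multiplicity l.
Proof.
move=> /finite_seqP[D sD].
have notD r : r \notin undup D -> s r = 0%N.
  rewrite mem_undup => /negP rD; apply: contrapT => sr; apply: rD.
  by have : [set r | s r <> 0%N] r by []; rewrite sD.
exists (flatten [seq nseq (s r) r | r <- undup D]); apply/funext => r.
rewrite /multiplicity count_flatten -map_comp sumnE big_map.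
under eq_bigr => z _ do rewrite /= count_nseq /=.
have [rD|rD] := boolP (r \in undup D).
  rewrite (bigD1_seq r) ?undup_uniq //= eqxx mul1n.
  by rewrite big1 ?addn0 // => z /negPf ->; rewrite mul0n.
rewrite notD // big_seq big1 // => z zD.
by case: eqVneq => // zr; move: zD rD; rewrite zr => ->.
Qed.

(** Finite support is part of the set because a sum with infinite support is
    zero by convention, and so is not linear in s. *)
Lemma convex_covered pi :
  convex_set ([set s | finite_set [set r | s r <> 0] /\
     1 <= \sum_(r \in [set: G]) pi r * s r] : set (convex_lmodType (G -> R^o))).
Proof.
move=> s1 s2 k; rewrite !inE => -[fin1 sum1] [fin2 sum2].
have fin : finite_set ([set r | s1 r <> 0] `|` [set r | s2 r <> 0]).
  by rewrite finite_setU.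
have /finite_seqP[D0 D0E] := fin.
pose D := undup D0.
have notD r : r \notin D -> s1 r = 0 /\ s2 r = 0.
  rewrite mem_undup => /negP rD.
  have : ~ ([set r | s1 r <> 0] `|` [set r | s2 r <> 0]) r by rewrite D0E.
  by move=> /not_orP[] /contrapT-> /contrapT->.
have kE r : (conv k s1 s2) r = k%:num * s1 r + (1 - k%:num) * s2 r by [].
split.
  apply: (sub_finite_set _ fin) => r /= kr; apply: contrapT => /not_orP[].
  move=> /contrapT s1r /contrapT s2r; apply: kr.
  by rewrite kE s1r s2r !mulr0 addr0.
have sumD (s : G -> R) : (forall r, r \notin D -> s r = 0) ->
    \sum_(r \in [set: G]) pi r * s r = \sum_(r <- D) pi r * s r.
  move=> sD; rewrite (fsbigE D) ?undup_uniq //.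
    by apply: eq_bigl => r; rewrite in_setT.
  by move=> r _ /sD ->; rewrite mulr0.
rewrite sumD => [|r /notD[s1r s2r]]; last by rewrite kE s1r s2r !mulr0 addr0.
move: sum1 sum2; rewrite !sumD => [sum1 sum2|r /notD[]//|r /notD[]//].
rewrite (eq_bigr (fun r =>
  k%:num * (pi r * s1 r) + (1 - k%:num) * (pi r * s2 r))).
  rewrite big_split /= -!mulr_sumr.
  have k0 : 0 <= k%:num by [].
  have k1 : 0 <= 1 - k%:num by rewrite subr_ge0.
  by rewrite -[leLHS](subrK k%:num) addrC lerD // ler_peMr.
by move=> r _; rewrite kE; ring.
Qed.

Definition solution l := exists2 t, S t & \sum_(r <- l) r = f + t.

(** The inequality that defines validity cuts out a convex set, so it holds on
    the hull as soon as it holds on the generators. *)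
Lemma valid_functionP pi :
  valid_function S f pi <->
  (forall r, 0 <= pi r) /\ forall l, solution l -> 1 <= \sum_(r <- l) pi r.
Proof.
split=> -[pi0 piV]; split=> //.
  move=> l lS; have := piV (fun r => (multiplicity l r)%:R).
  have -> : \sum_(r \in [set: G]) pi r * (multiplicity l r)%:R =
      \sum_(r <- l) pi r.
    by under eq_fsbigr do rewrite mulr_natr; exact: fsum_multiplicity.
  apply; apply: sub_gen_smallest => /=; exists (multiplicity l) => //.
  split; first exact: finite_multiplicity.
  by case: lS => t St lt; exists t => //; rewrite (fsum_multiplicity id).
move=> s /(smallest_sub (@convex_covered pi)); case=> // _ [s0 [s0fin s0S] <-].
have [l s0l] := finite_support_multiplicity s0fin; subst s0; split.
  by apply: sub_finite_set s0fin => r /= + mr; apply; rewrite mr.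
under eq_fsbigr do rewrite mulr_natr.
rewrite fsum_multiplicity; apply: piV.
by case: s0S => t St; rewrite (fsum_multiplicity id) => lt; exists t.
Qed.

(** The Gomory-Johnson characterization of minimality. *)
Definition gj_conditions pi :=
  [/\ forall r, 0 <= pi r, forall t, S t -> pi t = 0,
      forall r r', pi (r + r') <= pi r + pi r' &
      forall r, pi r + pi (f - r) = 1].

Lemma subadditive_sum pi l : pi 0 = 0 ->
  (forall r r', pi (r + r') <= pi r + pi r') ->
  pi (\sum_(r <- l) r) <= \sum_(r <- l) pi r.
Proof.
move=> pi0 sub; elim: l => [|r l IH]; first by rewrite !big_nil pi0.
by rewrite !big_cons (le_trans (sub _ _)) // lerD2l.
Qed.

Hypothesis S0 : S 0.
Hypothesis SB : forall t t', S t -> S t' -> S (t - t').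

Let SN t : S t -> S (- t). Proof. by move=> St; rewrite -sub0r; exact: SB. Qed.
Let SD t t' : S t -> S t' -> S (t + t').
Proof. by move=> St /SN St'; rewrite -[t']opprK; exact: SB. Qed.

(** By subadditivity the sum over a solution is at least the value of pi at
    f + t, which symmetry pairs with the zero - t of pi. *)
Lemma gj_valid pi : gj_conditions pi -> valid_function S f pi.
Proof.
move=> [pi0 piS sub sym]; apply/valid_functionP; split=> // l [t St lt].
apply: le_trans (subadditive_sum l (piS _ S0) sub).
rewrite lt -(sym (f + t)) opprD addrA subrr sub0r (piS (- t)) ?addr0 //.
exact: SN.
Qed.

Lemma valid_sum2 pi r : valid_function S f pi -> 1 <= pi r + pi (f - r).
Proof.
move=> /valid_functionP[_ /(_ [:: r; f - r])].
rewrite !big_cons !big_nil !addr0; apply; exists 0 => //.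
by rewrite !big_cons big_nil !addr0 addrC subrK.
Qed.

(** Lowering pi at r would break the inequality between pi r and pi (f - r)
    imposed by the solution [:: r; f - r]. *)
Lemma gj_minimal pi : gj_conditions pi -> minimal_valid S f pi.
Proof.
move=> pigj; split; first exact: gj_valid.
case: pigj => _ _ _ sym [pi' [pi'V pi'pi pi'le]].
apply: pi'pi; apply/funext => r; apply/eqP; rewrite eq_le pi'le /=.
by have := valid_sum2 r pi'V; have := sym r; have := pi'le (f - r); lra.
Qed.

Lemma minimal_eq pi pi' : minimal_valid S f pi -> valid_function S f pi' ->
  (forall r, pi' r <= pi r) -> pi' = pi.
Proof.
move=> [_ pimin] pi'V pi'le; apply: contrapT => ne; apply: pimin.
by exists pi'.
Qed.

(** Elements of S can be dropped from any solution, so their value can be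
    lowered to zero. *)
Lemma minimal_zero pi t : minimal_valid S f pi -> S t -> pi t = 0.
Proof.
move=> pimin St; have /valid_functionP[pi0 piV] := pimin.1.
pose pi' r := if r \in S then 0 else pi r.
rewrite -(minimal_eq (pi' := pi') pimin); first by rewrite /pi' mem_set.
  apply/valid_functionP; split=> [r|l [t' St' lt']].
    by rewrite /pi'; case: ifP.
  have SS : S (\sum_(r <- l | r \in S) r).
    by apply: big_ind => // r; rewrite inE.
  rewrite (eq_bigr (fun r => if r \notin S then pi r else 0)).
    rewrite -big_mkcond -big_filter; apply: piV.
    exists (t' - \sum_(r <- l | r \in S) r); first exact: SB.
    rewrite big_filter addrA -lt' (bigID (mem S) xpredT) /=.
    by rewrite addrAC subrr add0r.
  by move=> r _; rewrite /pi'; case: (r \in S).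
by move=> r; rewrite /pi'; case: ifP.
Qed.

(** Each copy of r + r' in a solution can be replaced by r and r', so the value
    at r + r' can be lowered to pi r + pi r'. *)
Lemma minimal_subadditive pi r r' : minimal_valid S f pi ->
  pi (r + r') <= pi r + pi r'.
Proof.
move=> pimin; rewrite leNgt; apply/negP => lt.
have /valid_functionP[pi0 piV] := pimin.1.
pose pi' u := if u == r + r' then pi r + pi r' else pi u.
have pi'le u : pi' u <= pi u by rewrite /pi'; case: eqP => // ->; exact: ltW.
have pi'V : valid_function S f pi'.
  apply/valid_functionP; split=> [u|l [t St lt']].
    by rewrite /pi'; case: ifP => // _; rewrite addr_ge0.
  pose l' := flatten [seq if u == r + r' then [:: r; r'] else [:: u] | u <- l].
  have sumE (V : nmodType) (h : G -> V) : \sum_(u <- l') h u =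
      \sum_(u <- l) if u == r + r' then h r + h r' else h u.
    rewrite big_flatten big_map; apply: eq_bigr => u _ /=.
    by case: ifP => _; rewrite ?big_seq1 // big_cons big_seq1.
  rewrite -sumE; apply: piV; exists t => //.
  by rewrite (sumE _ id) -lt'; apply: eq_bigr => u _; case: eqP.
have := minimal_eq pimin pi'V pi'le.
by move/(congr1 (@^~ (r + r'))); rewrite /pi' eqxx; lra.
Qed.

(** If c = pi r + pi (f - r) > 1, the value at r can be divided by c: a
    solution containing r has cost at least c for pi, since its other elements
    sum to f - r modulo S, hence cost at least 1 after division by c. *)
Lemma minimal_symmetric pi r : minimal_valid S f pi -> pi r + pi (f - r) = 1.
Proof.
move=> pimin; have /valid_functionP[pi0 piV] := pimin.1.
wlog pir : r / 0 < pi r.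
  move=> wl; have := pi0 r; rewrite le_eqVlt => /predU1P[pir|/wl//].
  have [|p] := ltP 0 (pi (f - r)).
    move=> /wl <-.
    by rewrite (_ : f - (f - r) = r) ?opprB 1?addrC ?subrK // addrC.
  by have := valid_sum2 r pimin.1; rewrite -pir; lra.
have c1 := valid_sum2 r pimin.1; apply/eqP; rewrite eq_le c1 andbT leNgt.
set c := _ + _ in c1 *; apply/negP => {}c1.
have c0 : 0 < c by lra.
pose pi' u := if u == r then pi r / c else pi u.
have pi'le u : pi' u <= pi u.
  by rewrite /pi'; case: eqP => // ->; rewrite ler_pdivrMr // ler_peMr // ltW.
have pi'ge u : pi u / c <= pi' u.
  rewrite /pi'; case: eqP => [->//|_].
  by rewrite ler_pdivrMr // ler_peMr // ltW.
have pi'V : valid_function S f pi'.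
  apply/valid_functionP; split=> [u|l [t St lt]].
    by apply: le_trans (pi'ge u); rewrite divr_ge0 // ltW.
  have [rl|rl] := boolP (r \in l); last first.
    rewrite big_seq (eq_bigr pi) -?big_seq; first by apply: piV; exists t.
    by move=> u ul; rewrite /pi'; case: eqP => // ur; rewrite -ur ul in rl.
  apply: (@le_trans _ _ ((\sum_(u <- l) pi u) / c)); last first.
    by rewrite mulr_suml; apply: ler_sum.
  rewrite ler_pdivlMr // mul1r (perm_big _ (perm_to_rem rl)) big_cons lerD2l.
  have piS u : S u -> pi u = 0 by exact: minimal_zero.
  apply: le_trans (subadditive_sum _ (piS _ S0) _); last first.
    by move=> u v; exact: minimal_subadditive.
  move: lt; rewrite (perm_big _ (perm_to_rem rl)) big_cons => lt.
  have -> : f - r = \sum_(u <- rem r l) u + - t.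
    by rewrite -[\sum_(u <- _) _](addKr r) lt; rewrite addrA addrK addrC.
  apply: le_trans (minimal_subadditive _ _ pimin) _.
  by rewrite (piS (- t)) ?addr0 //; exact: SN.
have := minimal_eq pimin pi'V pi'le; move/(congr1 (@^~ r)).
rewrite /pi' eqxx => /eqP.
rewrite eq_sym -subr_eq0 -[X in X - _]mulr1 -mulrBr mulf_eq0 gt_eqF //=.
by rewrite subr_eq0 eq_sym invr_eq1 => /eqP cE; rewrite cE ltxx in c1.
Qed.

Lemma minimal_gj pi : minimal_valid S f pi -> gj_conditions pi.
Proof.
move=> pimin; split; first by case: pimin.1.
- by move=> t; exact: minimal_zero.
- by move=> r r'; exact: minimal_subadditive.
- by move=> r; exact: minimal_symmetric.
Qed.

(** A valid function below pi1 would give, averaged with pi2, one below pi. *)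
Lemma average_minimal pi pi1 pi2 : minimal_valid S f pi ->
  valid_function S f pi1 -> valid_function S f pi2 ->
  pi = (fun r => 2^-1 * (pi1 r + pi2 r)) -> minimal_valid S f pi1.
Proof.
move=> pimin pi1V pi2V piE; split=> // -[pi1' [pi1'V + pi1'le]]; apply.
have piV : valid_function S f (fun r => 2^-1 * (pi1' r + pi2 r)).
  move: pi1'V pi2V => /valid_functionP[pi1'0 pi1'V] /valid_functionP[pi20 pi2V].
  apply/valid_functionP; split=> [r|l lS].
    by rewrite mulr_ge0 ?addr_ge0 ?invr_ge0.
  rewrite -mulr_sumr big_split /=.
  by have := pi1'V l lS; have := pi2V l lS; lra.
have le r : 2^-1 * (pi1' r + pi2 r) <= pi r.
  by rewrite piE; have := pi1'le r; lra.
apply/funext => r; have := minimal_eq pimin piV le; rewrite piE.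
by move=> /(congr1 (@^~ r)); lra.
Qed.

End ValidFunctions.

(** * Functions that are affine between consecutive integers *)

Section IntegerAffine.
Context {R : realType}.
Implicit Types (P Q : R -> R) (F : int -> R) (k a b : int) (s t : R).

Definition integer_affine P := forall k s, 0 <= s <= 1 ->
  P (k%:~R + s) = (1 - s) * P k%:~R + s * P (k + 1)%:~R.

Lemma floor_decomposition (y : R) :
  exists k s, [/\ 0 <= s, s < 1 & y = k%:~R + s].
Proof.
exists (Num.floor y), (y - (Num.floor y)%:~R).
by have := floor_itv y; rewrite intrD => /andP[? ?]; split; lra.
Qed.

Lemma integer_affine_eq P Q : integer_affine P -> integer_affine Q ->
  (forall k, P k%:~R = Q k%:~R) -> P =1 Q.
Proof.
move=> Paff Qaff PQ y; have [k [s [s0 s1 ->]]] := floor_decomposition y.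
by rewrite Paff ?Qaff ?PQ ?s0 ?ltW.
Qed.

Definition interpolation F (y : R) : R :=
  let k := Num.floor y in
  (1 - (y - k%:~R)) * F k + (y - k%:~R) * F (k + 1).

Lemma interpolation_int F k : interpolation F k%:~R = F k.
Proof. by rewrite /interpolation intrKfloor subrr subr0 mul1r mul0r addr0. Qed.

Lemma interpolation_affine F : integer_affine (interpolation F).
Proof.
move=> k s /andP[s0]; rewrite !interpolation_int le_eqVlt => /predU1P[->|s1].
  have -> : k%:~R + 1 = (k + 1)%:~R :> R by rewrite intrD.
  by rewrite interpolation_int subrr mul0r mul1r add0r.
have fl : Num.floor (k%:~R + s) = k.
  by apply/floor_def; rewrite intrD; apply/andP; split; lra.
by rewrite /interpolation fl [k%:~R + s]addrC addrK.
Qed.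

(** The sign sg lets one statement cover the cells on both sides of k; below it
    covers the two kinds of triangles. *)
Lemma integer_affine_sign P k (sg : int) s : integer_affine P ->
  sg = 1 \/ sg = -1 -> 0 <= s <= 1 ->
  P (k%:~R + sg%:~R * s) = (1 - s) * P k%:~R + s * P (k + sg)%:~R.
Proof.
move=> Paff [->|->] s01; first by rewrite mul1r Paff.
have := Paff (k - 1) (1 - s); rewrite subrK intrB => /(_ _).
rewrite -addrA [_ + (1 - s)]addrA [- 1 + 1]addrC subrr add0r mulN1r => ->.
  by ring.
by move: s01; lra.
Qed.

Definition defect P (x y : R) : R := P x + P y - P (x + y).

(** On the triangle with vertices (a, b), (a + sg, b) and (a, b + sg), each of
    x, y and x + y stays within one cell, so the defect is affine there. *)
Lemma defect_triangle P a b (sg : int) s t : integer_affine P ->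
  sg = 1 \/ sg = -1 -> 0 <= s -> 0 <= t -> s + t <= 1 ->
  defect P (a%:~R + sg%:~R * s) (b%:~R + sg%:~R * t) =
    (1 - s - t) * defect P a%:~R b%:~R + s * defect P (a + sg)%:~R b%:~R
    + t * defect P a%:~R (b + sg)%:~R.
Proof.
move=> Paff sgE s0 t0 st1; rewrite /defect.
have -> : a%:~R + sg%:~R * s + (b%:~R + sg%:~R * t) =
    (a + b)%:~R + sg%:~R * (s + t) :> R by rewrite intrD; ring.
rewrite !integer_affine_sign //; try (by apply/andP; split; lra).
have -> : (a + sg)%:~R + b%:~R = (a + b + sg)%:~R :> R by rewrite !intrD; ring.
have -> : a%:~R + (b + sg)%:~R = (a + b + sg)%:~R :> R by rewrite !intrD; ring.
by rewrite -intrD; ring.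
Qed.

(** Every point lies in a triangle, based at the lower left corner of its unit
    square if s + t <= 1 and at the upper right corner otherwise. *)
Lemma integer_affine_subadditive P : integer_affine P ->
  (forall a b, 0 <= defect P a%:~R b%:~R) -> forall x y, 0 <= defect P x y.
Proof.
move=> Paff sub x y.
have [a [s [s0 s1 ->]]] := floor_decomposition x.
have [b [t [t0 t1 ->]]] := floor_decomposition y.
have [st|st] := leP (s + t) 1.
  have := defect_triangle a b Paff (or_introl erefl) s0 t0 st.
  rewrite !mul1r => ->.
  by rewrite !addr_ge0 // mulr_ge0 //; lra.
have -> : a%:~R + s = (a + 1)%:~R + (-1)%:~R * (1 - s) :> R.
  by rewrite intrD; ring.
have -> : b%:~R + t = (b + 1)%:~R + (-1)%:~R * (1 - t) :> R.
  by rewrite intrD; ring.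
rewrite defect_triangle //; [|by right|lra|lra|lra].
by rewrite !addr_ge0 // mulr_ge0 //; lra.
Qed.

Lemma integer_affine_symmetric P (g : int) c : integer_affine P ->
  (forall k, P k%:~R + P (g - k)%:~R = c) -> forall y, P y + P (g%:~R - y) = c.
Proof.
move=> Paff sym y; have [k [s [s0 s1 ->]]] := floor_decomposition y.
have -> : g%:~R - (k%:~R + s) = (g - k)%:~R + (-1)%:~R * s :> R.
  by rewrite intrB; ring.
rewrite Paff ?integer_affine_sign //; [|by right|lra|lra].
rewrite (_ : g - k + -1 = g - (k + 1)); last by ring.
have gE i : P (g - i)%:~R = c - P i%:~R by have := sym i; lra.
by rewrite !gE; ring.
Qed.

(** A nonzero value |u s| could be doubled for ever: at 2 s if this is still in
    [0, 1], and otherwise at 2 (1 - s), because u (1 - s) = - u s. *)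
Lemma bounded_additive_eq0 (u : R -> R) (M : R) :
  (forall s, 0 <= s <= 1 -> `|u s| <= M) ->
  (forall s t, 0 <= s -> 0 <= t -> s + t <= 1 -> u s + u t = u (s + t)) ->
  u 1 = 0 -> forall s, 0 <= s <= 1 -> u s = 0.
Proof.
move=> uM uD u1.
have double s : 0 <= s <= 1 -> exists2 t, 0 <= t <= 1 & `|u t| = 2 * `|u s|.
  move=> /andP[s0 s1].
  have twice z : 0 <= z -> z + z <= 1 -> `|u (z + z)| = 2 * `|u z|.
    by move=> z0 z1; rewrite -uD // -mulr2n normrMn mulr_natl.
  have [ss|ss] := leP (s + s) 1.
    by exists (s + s); [apply/andP; split; lra|exact: twice].
  have us : u (1 - s) = - u s.
    by apply/eqP; rewrite -addr_eq0 addrC uD ?subr_ge0 // addrC subrK ?u1.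
  exists ((1 - s) + (1 - s)); first by apply/andP; split; lra.
  by rewrite twice ?us ?normrN //; lra.
have power n s : 0 <= s <= 1 -> 2 ^+ n * `|u s| <= M.
  elim: n s => [|n IH] s s01; first by rewrite mul1r; exact: uM.
  have [t t01 tE] := double s s01.
  by rewrite exprSr -mulrA -tE; exact: IH.
move=> s s01; apply/eqP; rewrite -normr_le0 leNgt; apply/negP => us.
have := power (Num.bound (M / `|u s|)) s s01; rewrite leNgt => /negP; apply.
by rewrite -ltr_pdivrMr //; exact: upper_nthrootP.
Qed.

(** * The zigzag perturbation *)

(** In the application P is pi rescaled by q, so that its breakpoints are
    integers, and Phi is the likewise rescaled difference between a summand of
    pi and pi. *)
Section Perturbation.
Variables (P Phi : R -> R) (M : R).
Hypothesis Paff : integer_affine P.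
Hypothesis Psub : forall x y, 0 <= defect P x y.
Hypothesis Phi_bounded : forall x, `|Phi x| <= M.
Hypothesis Phi_additive : forall x y, defect P x y = 0 -> defect Phi x y = 0.
Hypothesis Phi_int : forall k, Phi k%:~R = 0.

Lemma Phi_add x y : defect P x y = 0 -> Phi (x + y) = Phi x + Phi y.
Proof. by move=> /Phi_additive /eqP; rewrite subr_eq0 => /eqP. Qed.

(** Along the two legs of the triangle, Phi on the cell of x + y agrees with Phi
    on the cells of x and of y; hence the three restrictions are one additive
    function, which vanishes at both ends of the cell. *)
Lemma full_triangle_eq0 a b (sg : int) : sg = 1 \/ sg = -1 ->
  (forall s t, 0 <= s -> 0 <= t -> s + t <= 1 ->
    defect P (a%:~R + sg%:~R * s) (b%:~R + sg%:~R * t) = 0) ->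
  forall s, 0 <= s <= 1 -> [/\ Phi (a%:~R + sg%:~R * s) = 0,
    Phi (b%:~R + sg%:~R * s) = 0 & Phi ((a + b)%:~R + sg%:~R * s) = 0].
Proof.
move=> sgE tri.
have sum s t : 0 <= s -> 0 <= t -> s + t <= 1 ->
    Phi ((a + b)%:~R + sg%:~R * (s + t)) =
    Phi (a%:~R + sg%:~R * s) + Phi (b%:~R + sg%:~R * t).
  move=> s0 t0 st; rewrite -Phi_add ?tri //; congr Phi.
  by rewrite intrD; ring.
have sum_a s : 0 <= s <= 1 ->
    Phi ((a + b)%:~R + sg%:~R * s) = Phi (a%:~R + sg%:~R * s).
  move=> /andP[s0 s1]; have := sum s 0 s0 (lexx _).
  by rewrite !addr0 mulr0 addr0 Phi_int addr0; exact.
have sum_b s : 0 <= s <= 1 ->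
    Phi ((a + b)%:~R + sg%:~R * s) = Phi (b%:~R + sg%:~R * s).
  move=> /andP[s0 s1]; have := sum 0 s (lexx _) s0.
  by rewrite !add0r mulr0 addr0 Phi_int add0r; exact.
have zero s : 0 <= s <= 1 -> Phi ((a + b)%:~R + sg%:~R * s) = 0.
  apply: (@bounded_additive_eq0
    (fun s => Phi ((a + b)%:~R + sg%:~R * s)) M) => //.
    move=> u v u0 v0 uv; rewrite sum // sum_a ?sum_b //; apply/andP; split; lra.
  by rewrite mulr1 -intrD Phi_int.
by move=> s s01; rewrite -sum_a // -sum_b // zero.
Qed.

(** A convex combination of nonnegative numbers is zero only if each number with
    positive weight is: the defect vanishes on the face spanned by the vertices
    of positive weight. *)
Lemma defect_triangle_vertices a b (sg : int) s t : sg = 1 \/ sg = -1 ->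
  0 <= s -> 0 <= t -> s + t <= 1 ->
  defect P (a%:~R + sg%:~R * s) (b%:~R + sg%:~R * t) = 0 ->
  [/\ s + t < 1 -> defect P a%:~R b%:~R = 0,
      0 < s -> defect P (a + sg)%:~R b%:~R = 0 &
      0 < t -> defect P a%:~R (b + sg)%:~R = 0].
Proof.
move=> sgE s0 t0 st1; rewrite defect_triangle //.
have st0 : 0 <= 1 - s - t by lra.
have := mulr_ge0 st0 (Psub a%:~R b%:~R).
have := mulr_ge0 s0 (Psub (a + sg)%:~R b%:~R).
have := mulr_ge0 t0 (Psub a%:~R (b + sg)%:~R).
have pos_eq0 (c D : R) : c * D = 0 -> 0 < c -> D = 0.
  by move=> + c0 => /eqP; rewrite mulf_eq0 gt_eqF //= => /eqP.
move=> e3 e2 e1 sum0; split=> c0.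
- by apply: (pos_eq0 (1 - s - t)); lra.
- by apply: (pos_eq0 s) => //; lra.
- by apply: (pos_eq0 t) => //; lra.
Qed.

Lemma interior_triangle_eq0 a b (sg : int) s t : sg = 1 \/ sg = -1 ->
  0 < s -> 0 < t -> s + t < 1 ->
  defect P (a%:~R + sg%:~R * s) (b%:~R + sg%:~R * t) = 0 ->
  forall s, 0 <= s <= 1 -> [/\ Phi (a%:~R + sg%:~R * s) = 0,
    Phi (b%:~R + sg%:~R * s) = 0 & Phi ((a + b)%:~R + sg%:~R * s) = 0].
Proof.
move=> sgE s0 t0 st1 /defect_triangle_vertices[] //; try exact: ltW.
move=> /(_ st1) D1 /(_ s0) D2 /(_ t0) D3.
apply: full_triangle_eq0 => // u v u0 v0 uv.
by rewrite defect_triangle // D1 D2 D3 !mulr0 !addr0.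
Qed.

Definition live k : bool :=
  `[< exists2 s, 0 <= s <= 1 & Phi (k%:~R + s) != 0 >].

Lemma not_live k :
  (forall s, 0 <= s <= 1 -> Phi (k%:~R + s) = 0) -> live k = false.
Proof. by move=> z; apply/asboolPn => -[s /z ->]; rewrite eqxx. Qed.

(** The defect vanishes on the whole edge, where Phi b = 0 makes Phi invariant
    under translation by b. *)
Lemma horizontal_live a b s : 0 < s < 1 ->
  defect P (a%:~R + s) b%:~R = 0 -> live (a + b) = live a.
Proof.
move=> /andP[s0 s1] ds.
have [||||D1 D2 _] := @defect_triangle_vertices a b 1 s 0 (or_introl erefl).
- exact: ltW.
- exact: lexx.
- by rewrite addr0 ltW.
- by rewrite mul1r mulr0 addr0.
have PhiE u : 0 <= u <= 1 -> Phi ((a + b)%:~R + u) = Phi (a%:~R + u).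
  move=> /andP[u0 u1].
  have -> : (a + b)%:~R + u = (a%:~R + u) + b%:~R :> R by rewrite intrD; ring.
  rewrite Phi_add ?Phi_int ?addr0 //.
  have := @defect_triangle P a b 1 u 0 Paff (or_introl erefl) u0 (lexx _).
  rewrite !mul1r !addr0 => ->//.
  by rewrite D1 ?D2 // ?addr0 // mul0r !mulr0 !addr0.
congr asbool; apply/propext; split=> -[u u01 Pu]; exists u => //.
  by rewrite -PhiE.
by rewrite PhiE.
Qed.

(** The defect vanishes on the whole edge from (a, b + 1) to (a + 1, b), where
    Phi (a + b + 1) = 0 makes Phi odd under the reflection that swaps the two
    cells. *)
Lemma diagonal_live a b s : 0 < s < 1 ->
  defect P (a%:~R + s) (b%:~R + (1 - s)) = 0 -> live a = live b.
Proof.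
move=> /andP[s0 s1] ds.
have [||||_ D2 D3] :=
  @defect_triangle_vertices a b 1 s (1 - s) (or_introl erefl).
- exact: ltW.
- by lra.
- by lra.
- by rewrite !mul1r.
have PhiE u : 0 <= u <= 1 -> Phi (a%:~R + u) = - Phi (b%:~R + (1 - u)).
  move=> /andP[u0 u1]; apply/eqP; rewrite -addr_eq0 -Phi_add.
    have -> : (a%:~R + u) + (b%:~R + (1 - u)) = (a + b + 1)%:~R :> R.
      by rewrite !intrD; ring.
    by rewrite Phi_int.
  have := @defect_triangle P a b 1 u (1 - u) Paff (or_introl erefl) u0.
  rewrite !mul1r => ->; try lra.
  by rewrite D2 ?D3 //; [ring|lra].
congr asbool; apply/propext; split=> -[u u01 Pu]; exists (1 - u); try lra.
  by rewrite -oppr_eq0 -PhiE.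
by rewrite PhiE; [rewrite oppr_eq0 subKr|lra].
Qed.

(** One pattern serves all live cells, so it has to be compatible with every
    translation and reflection: it is odd about the midpoint of the cell. *)
Definition zigzag_value (m : int) : R :=
  if m == 1 then 1 else if m == 3 then -1 else 0.

Definition zigzag (i : int) : R :=
  if live (i %/ 4)%Z then zigzag_value (i %% 4)%Z else 0.

Definition quarter (i : int) : R := i%:~R / 4.

Lemma zigzag_quarter a (r : int) : 0 <= r < 4 ->
  zigzag (a * 4 + r) = if live a then zigzag_value r else 0.
Proof.
move=> r4; rewrite /zigzag divzMDl // modzMDl.
by rewrite divz_small ?modz_small // addr0.
Qed.

Lemma quarterD i j : quarter (i + j) = quarter i + quarter j.
Proof. by rewrite /quarter intrD mulrDl. Qed.

Lemma quarter_mul4 a : quarter (a * 4) = a%:~R.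
Proof. by rewrite /quarter intrM mulfK // intr_eq0. Qed.

Lemma interior_not_live a b (s t : R) : 0 < s -> 0 < t -> s + t < 1 ->
  defect P (a%:~R + s) (b%:~R + t) = 0 ->
  [/\ live a = false, live b = false & live (a + b) = false].
Proof.
move=> s0 t0 st1.
have := @interior_triangle_eq0 a b 1 s t (or_introl erefl) s0 t0 st1.
rewrite !mul1r => /[apply] zero.
by split; apply: not_live => u /zero; rewrite mul1r => -[].
Qed.

(** In the upper triangle the base vertex is (a + 1, b + 1) and the coordinates
    run backwards; x + y lies in the cell of a + b + 1. *)
Lemma interior_not_live_upper a b (s t : R) : s < 1 -> t < 1 -> 1 < s + t ->
  defect P (a%:~R + s) (b%:~R + t) = 0 ->
  [/\ live a = false, live b = false & live (a + b + 1) = false].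
Proof.
move=> s1 t1 st1 ds.
have flip k (u : R) :
    k%:~R + u = (k + 1)%:~R + (-1)%:~R * (1 - u) :> R by rewrite intrD; ring.
rewrite (flip a s) (flip b t) in ds.
have u01 (u : R) : 0 <= u <= 1 -> 0 <= 1 - u <= 1 by lra.
have [s1' t1' st1'] : [/\ 0 < 1 - s, 0 < 1 - t & 1 - s + (1 - t) < 1].
  by split; lra.
have zero := interior_triangle_eq0 (or_intror erefl) s1' t1' st1' ds.
have sumE : a + 1 + (b + 1) = a + b + 1 + 1 by ring.
rewrite sumE in zero.
by split; apply: not_live => u u1; rewrite flip; have [] := zero _ (u01 _ u1).
Qed.

(** With a and b the cells of i and j, and r and r' their remainders modulo 4,
    the point lies at a vertex of the triangulation, on an edge, or inside a
    triangle, according to which of r, r' and r + r' are multiples of 4. *)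
Lemma zigzag_additive i j : defect P (quarter i) (quarter j) = 0 ->
  zigzag i + zigzag j = zigzag (i + j).
Proof.
rewrite (divz_eq i 4) (divz_eq j 4).
have : 0 <= (i %% 4)%Z < 4 by rewrite modz_ge0 // ltz_pmod.
have : 0 <= (j %% 4)%Z < 4 by rewrite modz_ge0 // ltz_pmod.
move: (i %/ 4)%Z (j %/ 4)%Z (i %% 4)%Z (j %% 4)%Z => a b r r' r'4 r4.
rewrite !quarterD !quarter_mul4 !zigzag_quarter //.
have quarter_gt0 m : 0 < m -> 0 < quarter m.
  by move=> m0; rewrite divr_gt0 // ltr0z.
have quarter_lt1 m : m < 4 -> quarter m < 1.
  by move=> m4; rewrite ltr_pdivrMr // mul1r (ltr_int _ m 4).
have zigzag_low : r + r' < 4 -> zigzag (a * 4 + r + (b * 4 + r')) =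
    if live (a + b) then zigzag_value (r + r') else 0.
  by move=> rr'; rewrite -zigzag_quarter; [congr zigzag; ring|lia].
have zigzag_value0 : zigzag_value 0 = 0 by [].
have [r0|r0] := eqVneq r 0; have [r'0|r'0] := eqVneq r' 0.
- move=> _; rewrite zigzag_low ?r0 ?r'0 // addr0 zigzag_value0.
  by do !case: ifP; rewrite ?addr0.
- have -> : quarter r = 0 by rewrite r0 /quarter mul0r.
  rewrite addr0 => d0; rewrite zigzag_low r0 ?add0r; last by lia.
  rewrite [a + b]addrC (@horizontal_live b a (quarter r')).
  + by rewrite zigzag_value0; case: ifP; rewrite add0r.
  + by rewrite quarter_gt0 ?quarter_lt1 //; lia.
  + by move: d0; rewrite /defect [P a%:~R + _]addrC [a%:~R + _]addrC.
- have -> : quarter r' = 0 by rewrite r'0 /quarter mul0r.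
  rewrite addr0 => d0; rewrite zigzag_low r'0 ?addr0; last by lia.
  rewrite (@horizontal_live a b (quarter r)) //.
  + by rewrite zigzag_value0; case: (live b); rewrite addr0.
  + by rewrite quarter_gt0 ?quarter_lt1 //; lia.
have q0 : 0 < quarter r by apply: quarter_gt0; lia.
have q1 : quarter r < 1 by apply: quarter_lt1; lia.
have q'0 : 0 < quarter r' by apply: quarter_gt0; lia.
have q'1 : quarter r' < 1 by apply: quarter_lt1; lia.
have [rr'|rr'|rr'] := ltgtP (r + r') 4.
- move=> /interior_not_live[]//; first by rewrite -quarterD quarter_lt1.
  by move=> -> -> ab; rewrite zigzag_low // ab addr0.
- move=> /interior_not_live_upper[]//.
    by rewrite -quarterD /quarter ltr_pdivlMr // mul1r (ltr_int _ 4).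
  move=> -> ->.
  rewrite (_ : _ + _ + (_ + _) = (a + b + 1) * 4 + (r + r' - 4)); last by ring.
  by rewrite zigzag_quarter; [move=> ->; rewrite addr0|lia].
- have -> : quarter r' = 1 - quarter r.
    apply/eqP; rewrite eq_sym subr_eq addrC -quarterD rr' /quarter.
    by rewrite divff.
  move=> /diagonal_live ->; last by rewrite q0.
  rewrite (_ : _ + _ + (_ + _) = (a + b + 1) * 4 + 0); last first.
    by rewrite (_ : r' = 4 - r); [ring|lia].
  rewrite zigzag_quarter // zigzag_value0 if_same.
  have -> : r' = 4 - r by lia.
  case: ifP => _; last by rewrite addr0.
  have : r = 1 \/ r = 2 \/ r = 3 by lia.
  by move=> [->|[->|->]]; rewrite /zigzag_value /= ?addr0 ?subrr ?addNr.
Qed.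

Lemma zigzag_mul4 a : zigzag (a * 4) = 0.
Proof. by rewrite -[a * 4]addr0 zigzag_quarter // /zigzag_value /= if_same. Qed.

Lemma zigzag_neq0 x : Phi x != 0 -> exists i, zigzag i != 0.
Proof.
have [k [s [s0 s1 ->]]] := floor_decomposition x => Phix.
exists (k * 4 + 1); rewrite zigzag_quarter //.
have -> : live k by apply/asboolP; exists s; rewrite // s0 ltW.
by rewrite /zigzag_value eqxx oner_eq0.
Qed.

End Perturbation.
End IntegerAffine.

(** * Piecewise linear functions on a grid containing the breakpoints *)

Lemma continuous_eq0_endpoints (R : realType) (h : R -> R) (a b : R) :
  continuous h -> a < b -> (forall y, a < y < b -> h y = 0) ->
  h a = 0 /\ h b = 0.
Proof.
move=> hcont ab h0; split.
- have ha : h y @[y --> a^'+] --> h a.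
    by apply: cvg_at_right_filter; exact: hcont.
  apply: (cvg_unique _ ha) => //; apply: cvg_near_cst; near=> y; apply: h0.
  by apply/andP; split; near: y; [exact: nbhs_right_gt|exact: nbhs_right_lt].
- have hb : h y @[y --> b^'-] --> h b.
    by apply: cvg_at_left_filter; exact: hcont.
  apply: (cvg_unique _ hb) => //; apply: cvg_near_cst; near=> y; apply: h0.
  by apply/andP; split; near: y; [exact: nbhs_left_gt|exact: nbhs_left_lt].
Unshelve. all: by end_near. Qed.

Section Breakpoints.
Context {R : realType} {n : nat}.
Variables (X : 'I_n.+1 -> R) (N : nat).
Hypothesis N_gt0 : (0 < N)%N.
Hypothesis X_subdivision : subdivision01 X.
Hypothesis X_frac : forall i, exists m : int, X i = m%:~R / N%:R.

Let NR_gt0 : 0 < N%:R :> R. Proof. by rewrite ltr0n. Qed.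

Lemma subdivision_le (i j : 'I_n.+1) : (i <= j)%N -> X i <= X j.
Proof.
case: X_subdivision => _ _ X_lt; rewrite leq_eqVlt => /predU1P[/val_inj->//|].
by move=> /X_lt/ltW.
Qed.

Lemma subdivision_ge0 i : 0 <= X i.
Proof. by case: X_subdivision => <- _ _; exact: subdivision_le. Qed.

Lemma subdivision_le1 i : X i <= 1.
Proof.
case: X_subdivision => _ <- _; apply: subdivision_le.
by rewrite -ltnS ltn_ord.
Qed.

Lemma subdivision_lt1 (i : 'I_n.+1) : (i < n)%N -> X i < 1.
Proof. by case: X_subdivision => _ <- X_lt lt_in; exact: X_lt. Qed.

(** A grid cell lies between two consecutive breakpoints because the breakpoints
    are grid points: if y is the fractional part of k / N, the lower one comes
    from the last X i <= y, and X (i + 1) > y is at least one grid step above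
    y. *)
Lemma consecutive_breakpoints (k : int) : exists a b : R,
  [/\ breakpoints X a, breakpoints X b,
      (forall c, breakpoints X c -> ~ (a < c < b)),
      a <= k%:~R / N%:R & (k + 1)%:~R / N%:R <= b].
Proof.
case: (X_subdivision) => X0 X1 X_lt.
pose z : R := k%:~R / N%:R; pose t := Num.floor z.
have /andP[tz] := floor_itv z; rewrite intrD -/t => zt.
have P0 : X ord0 <= z - t%:~R by rewrite X0 subr_ge0.
have [i Xi imax] :=
  @arg_maxnP _ ord0 (fun i => X i <= z - t%:~R) (@nat_of_ord _) P0.
have lt_in : (i < n)%N.
  rewrite ltnNge; apply/negP => le_ni.
  have := subdivision_le (i := ord_max) (j := i) le_ni.
  by rewrite X1; lra.
pose j : 'I_n.+1 := Ordinal (lt_in : (i.+1 < n.+1)%N).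
have Xj : z - t%:~R < X j.
  by rewrite ltNge; apply/negP => /imax; rewrite /= ltnn.
exists (X i + t%:~R), (X j + t%:~R); split.
- by exists i, t.
- have [jn|jn] := ltnP j n; first by exists j, t.
  have -> : X j = 1.
    by apply/eqP; rewrite eq_le subdivision_le1 -X1 subdivision_le.
  (* The index n is excluded from the breakpoints: X n + t is X 0 + (t + 1). *)
  by exists ord0, (1 + t); rewrite X0 add0r intrD (leq_ltn_trans _ lt_in).
- move=> _ [l [t' [lt_ln ->]]] /andP[].
  have := subdivision_ge0 l; have := subdivision_lt1 lt_ln.
  have := subdivision_ge0 i; have := subdivision_le1 j => Xj1 Xi0 Xl1 Xl0 il lj.
  have t't : t' = t.
    have : (t'%:~R < (t + 1)%:~R :> R) by rewrite intrD; lra.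
    have : (t%:~R < (t' + 1)%:~R :> R) by rewrite intrD; lra.
    by rewrite !ltr_int; lia.
  subst t'; move: il lj; rewrite !ltrD2r => il lj.
  have [li|li] := leqP l i.
    by have := subdivision_le li; rewrite leNgt il.
  by have := subdivision_le (i := j) li; rewrite leNgt lj.
- by rewrite -/z; lra.
- have [m Xjm] := X_frac j; move: Xj.
  have tE : t%:~R = (t * N%:Z)%:~R / N%:R :> R.
    by rewrite intrM mulfK ?lt0r_neq0.
  rewrite Xjm /z ltrBlDr tE -mulrDl ltr_pM2r ?invr_gt0 // => lt_k.
  rewrite ler_pM2r ?invr_gt0 //; move: lt_k.
  by rewrite -!intrD ltr_int ler_int; lia.
Qed.

Lemma piecewise_linear_integer_affine (pi : R -> R) : continuous pi ->
  piecewise_linear (breakpoints X) pi ->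
  integer_affine (fun y => pi (y / N%:R)).
Proof.
move=> pi_cont [_ _ pi_lin] k s /andP[s0 s1].
have [a [b [Ba Bb ab_cons ak kb]]] := consecutive_breakpoints k.
have lt_k : k%:~R / N%:R < (k + 1)%:~R / N%:R :> R.
  by rewrite ltr_pM2r ?invr_gt0 // ltr_int; lia.
have ab : a < b by apply: le_lt_trans ak (lt_le_trans lt_k kb).
have [m [c pi_ab]] := pi_lin a b Ba Bb ab ab_cons.
have piE y : a <= y <= b -> pi y = m * y + c.
  have [pia pib] : pi a - (m * a + c) = 0 /\ pi b - (m * b + c) = 0.
    apply: (@continuous_eq0_endpoints R (fun y => pi y - (m * y + c))) => //.
      move=> w; apply: cvgB; first exact: pi_cont.
      apply: cvgD; last exact: cvg_cst.
      by apply: cvgM; [exact: cvg_cst|exact: cvg_id].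
    by move=> z /pi_ab ->; rewrite subrr.
  move=> /andP[]; rewrite le_eqVlt => /predU1P[<- _|ay].
    by apply/eqP; rewrite -subr_eq0 pia.
  rewrite le_eqVlt => /predU1P[->|yb].
    by apply/eqP; rewrite -subr_eq0 pib.
  by apply: pi_ab; rewrite ay.
set u := k%:~R / N%:R in ak lt_k *; set v := (k + 1)%:~R / N%:R in kb lt_k *.
have -> : (k%:~R + s) / N%:R = (1 - s) * u + s * v.
  by rewrite /u /v intrD; field; rewrite lt0r_neq0.
have vu : 0 <= s * (v - u) by rewrite mulr_ge0 // subr_ge0 ltW.
have vu' : 0 <= (1 - s) * (v - u) by rewrite mulr_ge0 ?subr_ge0 // ltW.
rewrite !piE; try (by apply/andP; split; lra).
by ring.
Qed.

End Breakpoints.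

Lemma integer_multiple_denominator n (x : 'I_n.+1 -> rat) (N : nat)
    (R : realType) i :
  (0 < N)%N -> (least_common_denominator x %| N)%N ->
  exists m : int, ratr (x i) = m%:~R / N%:R :> R.
Proof.
move=> N0 lN; have /dvdnP[d Nd] : (`|denq (x i)| %| N)%N.
  by apply: dvdn_trans lN; apply: biglcmn_sup.
exists (numq (x i) * d%:Z); rewrite /ratr Nd natrM intrM.
have -> : (denq (x i))%:~R = `|denq (x i)|%:R :> R.
  by rewrite -[RHS]/((`|denq (x i)|%:Z)%:~R) absz_denq.
have d0 : d%:R != 0 :> R.
  by rewrite pnatr_eq0; apply: contraTneq N0 => d0; rewrite Nd d0.
have dq0 : `|denq (x i)|%:R != 0 :> R by rewrite pnatr_eq0 absz_eq0 denq_neq0.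
by rewrite -[d%:~R]/(d%:R); field; rewrite d0 dq0.
Qed.

Lemma least_common_denominator_gt0 n (x : 'I_n.+1 -> rat) :
  (0 < least_common_denominator x)%N.
Proof.
rewrite /least_common_denominator.
apply: (big_ind (fun m => (0 < m)%N)) => // [a b a0 b0|i _].
  by rewrite lcmn_gt0 a0.
by rewrite absz_gt0 denq_neq0.
Qed.

(** * Perturbations on a cyclic group *)

Lemma gj_pullback (R : realType) (G H : zmodType) (S : set G) (S' : set H)
    (f : G) (f' : H) (h : H -> G) (pi : G -> R) :
  {morph h : x y / x + y} -> (forall t, S' t -> S (h t)) -> h f' = f ->
  gj_conditions S f pi -> gj_conditions S' f' (pi \o h).
Proof.
move=> hD hS hf [pi0 piS sub sym]; split=> //=.
- by move=> t /hS; exact: piS.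
- by move=> r r'; rewrite hD.
- move=> r; rewrite -(sym (h r)); congr (_ + pi _).
  by apply/eqP; rewrite eq_sym subr_eq -hD subrK hf.
Qed.

Lemma gj_target (R : realType) (G : zmodType) (S : set G) (f : G)
    (pi : G -> R) :
  S 0 -> gj_conditions S f pi -> pi f = 1.
Proof. by move=> S0 [_ piS _ sym]; rewrite -(sym f) subrr (piS _ S0) addr0. Qed.

Lemma gj_le1 (R : realType) (G : zmodType) (S : set G) (f : G) (pi : G -> R) r :
  gj_conditions S f pi -> pi r <= 1.
Proof. by move=> [pi0 _ _ sym]; rewrite -(sym r) lerDl. Qed.

Definition multiples (N : nat) : set int := [set k | exists m, k = m * N%:Z].

Lemma multiples0 N : multiples N 0.
Proof. by exists 0; rewrite mul0r. Qed.

Lemma common_small_factor (R : realType) (T : finType) (slack delta : T -> R) :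
  (forall t, 0 <= slack t) -> (forall t, slack t = 0 -> delta t = 0) ->
  exists2 eps, 0 < eps & forall t, eps * `|delta t| <= slack t.
Proof.
move=> slack0 delta0; pose E := \sum_t `|delta t| / slack t.
have E0 : 0 <= E by apply: sumr_ge0 => t _; rewrite divr_ge0.
(* Terms with slack t = 0 contribute 0 to E, as their delta vanishes; the
   others satisfy delta / slack <= E. *)
exists (1 + E)^-1 => [|t]; first by rewrite invr_gt0; lra.
rewrite mulrC ler_pdivrMr; last by lra.
have := slack0 t; rewrite le_eqVlt => /predU1P[st|st].
  by rewrite -st (delta0 t) // normr0 mul0r.
rewrite mulrC -ler_pdivrMr //; apply: le_trans (_ : E <= _); last by lra.
by rewrite /E (bigD1 t) //= lerDl sumr_ge0 // => u _; rewrite divr_ge0.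
Qed.

(** The group (1/N)Z is represented by its numerators, and its subgroup Z by the
    multiples of N. *)
Section CyclicPerturbation.
Context {R : realType}.
Variables (N : nat) (g : int) (F w : int -> R).
Hypothesis N_gt0 : (0 < N)%N.
Hypothesis F_gj : gj_conditions (multiples N) g F.
Hypothesis w_additive :
  forall i j, F i + F j = F (i + j) -> w i + w j = w (i + j).
Hypothesis w_multiples : forall m, w (m * N%:Z) = 0.
Hypothesis w_target : w g = 0.

Let N_neq0 : N%:Z != 0. Proof. by move: N_gt0; lia. Qed.

Lemma cyclic_periodic i m : F (m * N%:Z + i) = F i.
Proof.
have [_ FS sub _] := F_gj; have FN k : F (k * N%:Z) = 0 by apply: FS; exists k.
apply/eqP; rewrite eq_le; apply/andP; split.
  by have := sub (m * N%:Z) i; rewrite FN add0r.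
have := sub (- m * N%:Z) (m * N%:Z + i); rewrite FN add0r.
by rewrite addrA -mulrDl addNr mul0r add0r.
Qed.

Lemma cyclic_periodic_perturbation i m : w (m * N%:Z + i) = w i.
Proof.
rewrite -w_additive ?w_multiples ?add0r // cyclic_periodic.
by have [_ -> //] := F_gj; [rewrite add0r|exists m].
Qed.

Lemma residue_decomposition i :
  exists (o : 'I_N) (m : int), i = m * N%:Z + (o : nat)%:Z.
Proof.
have r0 := modz_ge0 i N_neq0.
have rN : (`|(i %% N%:Z)%Z| < N)%N.
  by rewrite -ltz_nat gez0_abs // ltz_pmod // ltz_nat.
by exists (Ordinal rN), (i %/ N%:Z)%Z; rewrite /= gez0_abs //; exact: divz_eq.
Qed.

(** By periodicity modulo N only finitely many instances of subadditivity
    matter; those that are tight for F stay tight, and a small perturbation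
    keeps the others.  Symmetry is a tight instance, as F r + F (g - r) = 1 =
    F g. *)
Lemma perturbation_gj : exists2 eps : R, 0 < eps &
  forall c, `|c| <= eps ->
    gj_conditions (multiples N) g (fun i => F i + c * w i).
Proof.
have [F0 FS sub sym] := F_gj.
pose slack i j := F i + F j - F (i + j).
pose delta i j := w i + w j - w (i + j).
have slack0 i j : 0 <= slack i j by rewrite subr_ge0.
have slack_delta i j : slack i j = 0 -> delta i j = 0.
  by move=> /eqP; rewrite subr_eq0 /delta => /eqP/w_additive->; rewrite subrr.
have [eps eps0 epsP] := @common_small_factor R ('I_N * 'I_N)%type
  (fun t => slack (t.1 : nat)%:Z (t.2 : nat)%:Z)
  (fun t => delta (t.1 : nat)%:Z (t.2 : nat)%:Z)
  (fun t => slack0 _ _) (fun t => @slack_delta _ _).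
exists eps => // c c_eps.
have subc i j : F (i + j) + c * w (i + j) <= F i + c * w i + (F j + c * w j).
  have [u [m ->]] := residue_decomposition i.
  have [u' [m' ->]] := residue_decomposition j.
  rewrite addrACA -mulrDl !cyclic_periodic !cyclic_periodic_perturbation.
  have := epsP (u, u'); rewrite /slack /delta /=.
  set d := _ - w _ => le_d; have cd : 0 - c * d <= eps * `|d|.
    rewrite sub0r; apply: le_trans (ler_norm _) _; rewrite normrN normrM.
    by rewrite ler_wpM2r.
  by move: le_d cd; rewrite /d; lra.
have zero t : multiples N t -> F t + c * w t = 0.
  move=> tN; rewrite FS //; case: tN => m ->.
  by rewrite w_multiples mulr0 addr0.
split=> //.
(* Nonnegativity: the value at N * r is 0 and at most N times the value at r. *)
- move=> r; have := @subadditive_sum R int (fun i => F i + c * w i) (nseq N r).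
  rewrite !big_nseq !iter_addr_0 (zero 0 (multiples0 N)) => /(_ erefl subc).
  rewrite zero; last by exists r; rewrite -mulrzz -pmulrn.
  by rewrite pmulrn_lge0.
- move=> r; have Fg := gj_target (multiples0 N) F_gj.
  have rg : r + (g - r) = g by rewrite addrC subrK.
  have := @w_additive r (g - r); rewrite rg sym Fg w_target => /(_ erefl).
  have := sym r; rewrite addrACA -mulrDr => -> ->; ring.
Qed.

End CyclicPerturbation.

(** * The subgroup (1/N)Z of the reals *)

Section Grid.
Context {R : realType}.
Variable N : nat.
Hypothesis N_gt0 : (0 < N)%N.

Let N_neq0 : N%:R != 0 :> R. Proof. by rewrite pnatr_eq0 -lt0n. Qed.

Fact grid_point_subproof (k : int) : (k%:~R / N%:R : R) \in @fracZ_pred R N.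
Proof. by apply/asboolP; exists k. Qed.

Definition grid_point (k : int) : fracZ R N := FracZ (grid_point_subproof k).

Lemma fracZ_valD : {morph @fracZ_val R N : r r' / r + r'}.
Proof. exact: (raddfD (val : fracZ R N -> R)). Qed.

Definition numerator (r : fracZ R N) : int := Num.floor (fracZ_val r * N%:R).

Lemma grid_pointK : cancel grid_point numerator.
Proof. by move=> k; rewrite /numerator /= mulfVK // intrKfloor. Qed.

Lemma numeratorK : cancel numerator grid_point.
Proof.
move=> r; apply: val_inj => /=; have /asboolP[k rk] := valP r.
by rewrite /numerator -[fracZ_val r]/(val r) rk mulfVK // intrKfloor.
Qed.

Lemma grid_pointD : {morph grid_point : k l / k + l}.
Proof.
by move=> k l; apply: val_inj; rewrite [RHS]fracZ_valD /= intrD mulrDl.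
Qed.

Lemma numeratorD : {morph numerator : r r' / r + r'}.
Proof.
move=> r r'; rewrite -{1}(numeratorK r) -{1}(numeratorK r').
by rewrite -grid_pointD grid_pointK.
Qed.

Lemma integers_grid_point k : multiples N k -> integers_in_fracZ (grid_point k).
Proof. by move=> [m ->]; exists m => //=; rewrite intrM mulfK. Qed.

Lemma multiples_numerator r : integers_in_fracZ r -> multiples N (numerator r).
Proof.
move=> [m _ mr]; exists m; apply: (can_inj grid_pointK).
by rewrite numeratorK; apply: val_inj; rewrite /= intrM mulfK.
Qed.

Lemma integers0 : integers (R := R) 0.
Proof. by exists 0. Qed.

Lemma integersB t t' : integers (R := R) t -> integers t' -> integers (t - t').
Proof. by move=> [m _ <-] [m' _ <-]; exists (m - m') => //; rewrite intrB. Qed.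

Lemma integers_in_fracZ0 : @integers_in_fracZ R N 0.
Proof. exact: integers0. Qed.

Lemma integers_in_fracZB (t t' : fracZ R N) :
  integers_in_fracZ t -> integers_in_fracZ t' -> integers_in_fracZ (t - t').
Proof.
move=> tZ t'Z; suff e : fracZ_val (t - t') = fracZ_val t - fracZ_val t'.
  by have := integersB tZ t'Z; rewrite -e.
exact: (raddfB (val : fracZ R N -> R)).
Qed.

Lemma interpolation_gj (F : int -> R) (g : int) :
  gj_conditions (multiples N) g F ->
  gj_conditions (@integers R) (g%:~R / N%:R)
    (fun y => interpolation F (y * N%:R)).
Proof.
move=> [F0 FS sub sym].
have aff := interpolation_affine F.
split.
- move=> r; have [k [s [s0 s1 ->]]] := floor_decomposition (r * N%:R).
  rewrite aff; last by rewrite s0 ltW.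
  rewrite !interpolation_int.
  by rewrite addr_ge0 // mulr_ge0 // subr_ge0 ltW.
- move=> _ [m _ <-]; rewrite -[N%:R]/((N%:Z)%:~R) -intrM interpolation_int.
  by apply: FS; exists m.
- move=> r r'; rewrite mulrDl -subr_ge0.
  apply: (integer_affine_subadditive aff).
  by move=> k l; rewrite /defect -intrD !interpolation_int subr_ge0.
- move=> r; rewrite mulrBl mulfVK //.
  by apply: (integer_affine_symmetric aff) => k; rewrite !interpolation_int.
Qed.

(** The value 1 at f is the maximum of pi.  If f were inside a cell [k, k + 1],
    pi would be 1 at both ends, and by symmetry 0 at s and s - 1, where
    f = k + s in grid units.  As pi 0 = 0 and pi >= 0, this gives pi = 0 at the
    grid points 1 and -1, hence at all grid points, contradicting pi = 1 at
    k. *)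
Lemma gj_target_on_grid (f : R) (pi : R -> R) :
  gj_conditions (@integers R) f pi ->
  integer_affine (fun y => pi (y / N%:R)) -> exists g : int, f = g%:~R / N%:R.
Proof.
move=> pi_gj aff; have [pi0 piS sub sym] := pi_gj.
pose P y := pi (y / N%:R); have P_le1 y : P y <= 1 by exact: gj_le1 pi_gj.
have [k [s [s0 s1 fE]]] := floor_decomposition (f * N%:R).
have {fE}fE : f = (k%:~R + s) / N%:R by rewrite -fE mulfK.
exists k; move: s0; rewrite le_eqVlt => /predU1P[s0|s0].
  by rewrite fE -s0 addr0.
exfalso; have s01 : 0 <= s <= 1 by rewrite !ltW.
have Pz y : P y = 1 -> P (k%:~R + s - y) = 0.
  have := sym (y / N%:R); rewrite {1}fE -mulrBl -/(P _) -/(P (_ - _)).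
  by move=> + y1; rewrite y1; lra.
have P0 : P 0 = 0 by rewrite /P mul0r piS //; exact: integers0.
have Pf : P (k%:~R + s) = 1 by rewrite /P -fE; exact: gj_target integers0 pi_gj.
have affP : integer_affine P := aff.
have pos_eq (c x y : R) : 0 < c -> 0 <= x -> 0 <= y -> 0 <= 1 - c ->
    (1 - c) * x + c * y = 0 -> y = 0.
  move=> c0 x0 y0 c1 e; have := mulr_ge0 c1 x0; have := mulr_ge0 (ltW c0) y0.
  have cy : c * y = 0 -> y = 0 by move/eqP; rewrite mulf_eq0 gt_eqF //= => /eqP.
  by move=> e1 e2; apply: cy; lra.
have [Pk Pk1] : P k%:~R = 1 /\ P (k + 1)%:~R = 1.
  have := affP k s s01; rewrite Pf => e.
  have a1 : 0 <= 1 - P k%:~R by rewrite subr_ge0.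
  have a2 : 0 <= 1 - P (k + 1)%:~R by rewrite subr_ge0.
  split; apply/eqP; rewrite eq_sym -subr_eq0; apply/eqP.
    apply: (pos_eq (1 - s) (1 - P (k + 1)%:~R)) => //; [lra|lra|].
    by move: e; lra.
  by apply: (pos_eq s (1 - P k%:~R)) => //; [lra|move: e; lra].
have P1 : P 1%:~R = 0.
  have := Pz _ Pk; rewrite (_ : _ + s - _ = 0%:~R + s); last first.
    by rewrite /=; ring.
  by rewrite affP // add0r; apply: pos_eq => //; [exact: pi0|exact: pi0|lra].
have PN1 : P (-1)%:~R = 0.
  have := Pz _ Pk1; rewrite (_ : _ + s - _ = (-1)%:~R + s); last first.
    by rewrite intrD; ring.
  rewrite affP // addNr addrC => e.
  by apply: (pos_eq (1 - s) (P 0%:~R)) => //; try exact: pi0; try lra.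
have Psub x y : P (x + y) <= P x + P y by rewrite /P mulrDl.
have Pnat (sg : int) : P sg%:~R = 0 -> forall i : nat, P (sg * i%:Z)%:~R = 0.
  move=> Psg; elim=> [|i IH]; first by rewrite mulr0.
  apply/eqP; rewrite eq_le pi0 andbT (_ : sg * i.+1%:Z = sg + sg * i%:Z).
    by rewrite intrD; apply: le_trans (Psub _ _) _; rewrite Psg IH addr0.
  by rewrite -addn1 PoszD mulrDr mulr1 addrC.
have : P k%:~R = 0.
  case: (intP k) => [|i|i]; first exact: P0.
  - by have := Pnat 1 P1 i.+1; rewrite mul1r.
  - by have := Pnat (-1) PN1 i.+1; rewrite mulN1r.
by rewrite Pk; apply/eqP; rewrite oner_eq0.
Qed.

End Grid.

(** * Extremality on the reals and on the grid *)

Lemma subdivision01_ratr (R : realType) n (x : 'I_n.+1 -> rat) :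
  subdivision01 x -> subdivision01 (fun i => ratr (x i) : R).
Proof.
move=> [x0 x1 x_lt]; split; rewrite ?x0 ?x1 ?rmorph0 ?rmorph1 //.
by move=> i j /x_lt; rewrite ltr_rat.
Qed.

Lemma average_gj (R : realType) (G : zmodType) (S : set G) (f : G)
    (pi pi1 pi2 : G -> R) : S 0 -> (forall t t', S t -> S t' -> S (t - t')) ->
  gj_conditions S f pi -> valid_function S f pi1 -> valid_function S f pi2 ->
  pi = (fun r => 2^-1 * (pi1 r + pi2 r)) ->
  gj_conditions S f pi1 /\ gj_conditions S f pi2.
Proof.
move=> S0 SB pi_gj v1 v2 piE; have pimin := gj_minimal S0 SB pi_gj.
split; apply: minimal_gj => //.
  exact: average_minimal pimin v1 v2 piE.
apply: average_minimal pimin v2 v1 _.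
by rewrite piE; apply/funext => r; rewrite addrC.
Qed.

Section Extremality.
Context {R : realType}.
Variables (N : nat) (g : int) (f : R) (pi : R -> R).
Hypothesis N_gt0 : (0 < N)%N.
Hypothesis fE : f = g%:~R / N%:R.
Hypothesis pi_gj : gj_conditions (@integers R) f pi.

Let N_neq0 : N%:R != 0 :> R. Proof. by rewrite pnatr_eq0 -lt0n. Qed.

Lemma restriction_gj (p : R -> R) : gj_conditions (@integers R) f p ->
  gj_conditions (@integers_in_fracZ R N) (grid_point N g)
    (fun r => p (fracZ_val r)).
Proof. by apply: gj_pullback; [exact: fracZ_valD|by []|rewrite fE]. Qed.

(** A decomposition of the restriction lifts to the reals by interpolation,
    which recovers pi itself as pi is affine on the cells. *)
Lemma extreme_restriction : integer_affine (fun y => pi (y / N%:R)) ->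
  extreme (@integers R) f pi ->
  extreme (@integers_in_fracZ R N) (grid_point N g) (fun r => pi (fracZ_val r)).
Proof.
move=> pi_aff [_ pi_ext]; have r_gj := restriction_gj pi_gj.
have Z0 := @integers_in_fracZ0 R N; have ZB := @integers_in_fracZB R N.
split; first exact: gj_valid.
move=> p1 p2 v1 v2 pE; have [gj1 gj2] := average_gj Z0 ZB r_gj v1 v2 pE.
pose lift (p : fracZ R N -> R) (y : R) : R :=
  interpolation (fun k => p (grid_point N k)) (y * N%:R).
have lift_valid p : gj_conditions (@integers_in_fracZ R N) (grid_point N g) p ->
    valid_function (@integers R) f (lift p).
  move=> p_gj; apply: (gj_valid integers0 integersB).
  rewrite fE; apply: interpolation_gj => //.
  by apply: gj_pullback p_gj; [exact: grid_pointD|exact: integers_grid_point|].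
have lift_grid_point p r : lift p (fracZ_val r) = p r.
  by rewrite -(numeratorK N_gt0 r) /lift /= mulfVK // interpolation_int.
have piE : pi = (fun y => 2^-1 * (lift p1 y + lift p2 y)).
  apply/funext => y; rewrite -[y](mulfK N_neq0).
  apply: (@integer_affine_eq R (fun y => pi (y / N%:R))
    (fun y => 2^-1 * (lift p1 (y / N%:R) + lift p2 (y / N%:R)))) => //.
    move=> k s s01; rewrite /lift !mulfVK // !interpolation_affine //; ring.
  move=> k; have := congr1 (@^~ (grid_point N k)) pE; rewrite /= => ->.
  by rewrite -(lift_grid_point p1) -(lift_grid_point p2).
have [e1 e2] := pi_ext _ _ (lift_valid _ gj1) (lift_valid _ gj2) piE.
split; apply/funext => r; first by rewrite -(lift_grid_point p1) -e1.
by rewrite -(lift_grid_point p2) -e2.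
Qed.

End Extremality.

(** Extremality of the restriction is used twice: on the restrictions of pi1 and
    pi2, to see that Phi vanishes on the grid, and on the two zigzag
    perturbations, to see that the zigzag is zero. *)
Lemma extreme_from_restriction (R : realType) (q : nat) (f : R) (fq : int)
    (pi : R -> R) : (0 < q)%N -> f = fq%:~R / q%:R ->
  gj_conditions (@integers R) f pi ->
  integer_affine (fun y => pi (y / q%:R)) ->
  extreme (@integers_in_fracZ R (4 * q)) (grid_point (4 * q) (fq * 4))
    (fun r => pi (fracZ_val r)) ->
  extreme (@integers R) f pi.
Proof.
move=> q0 fE pi_gj pi_aff [_ r_ext].
set N := (4 * q)%N in r_ext *; have N0 : (0 < N)%N by rewrite muln_gt0.
have qR0 : q%:R != 0 :> R by rewrite pnatr_eq0 -lt0n.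
have NR0 : N%:R != 0 :> R by rewrite pnatr_eq0 -lt0n.
have fN : f = (fq * 4)%:~R / N%:R.
  by rewrite fE /N natrM intrM -[4%:~R]/(4%:R); field.
have r_gj p := @restriction_gj R N (fq * 4) f fN p.
have Z0 := @integers_in_fracZ0 R N; have ZB := @integers_in_fracZB R N.
have restr_valid (p1 : R -> R) : gj_conditions (@integers R) f p1 ->
  valid_function (@integers_in_fracZ R N) (grid_point N (fq * 4))
    (fun r => p1 (fracZ_val r)).
  by move=> p1_gj; exact: (gj_valid Z0 ZB (r_gj _ p1_gj)).
split; first exact: (gj_valid integers0 integersB pi_gj).
suff pi1E pi1 pi2 : valid_function (@integers R) f pi1 ->
    valid_function (@integers R) f pi2 ->
    pi = (fun r => 2^-1 * (pi1 r + pi2 r)) -> pi = pi1.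
  move=> pi1 pi2 v1 v2 piE; split; first exact: pi1E v1 v2 piE.
  by apply: pi1E v2 v1 _; rewrite piE; apply/funext => r; rewrite addrC.
move=> v1 v2 piE.
have [gj1 gj2] := average_gj integers0 integersB pi_gj v1 v2 piE.
have piEr r : pi r = 2^-1 * (pi1 r + pi2 r) by rewrite {1}piE.
have [rE _] := r_ext _ _ (restr_valid _ gj1) (restr_valid _ gj2)
  (funext (fun r => piEr (fracZ_val r))).
apply: contrapT => ne.
pose P y := pi (y / q%:R); pose Phi y := pi1 (y / q%:R) - pi (y / q%:R).
have [x Phix] : exists x, Phi x != 0.
  apply: contrapT => Phi0; apply: ne; apply/funext => y; apply/eqP.
  rewrite eq_sym -subr_eq0; apply: contrapT => /negP y0; apply: Phi0.
  by exists (y * q%:R); rewrite /Phi mulfK.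
have [pi0 piS pi_sub pi_sym] := pi_gj.
have [pi10 pi1S pi1_sub pi1_sym] := gj1; have [_ _ pi2_sub _] := gj2.
have Psub y z : 0 <= defect P y z by rewrite /defect /P mulrDl subr_ge0.
have Phi_bounded y : `|Phi y| <= 1.
  rewrite ler_norml; have := gj_le1 (y / q%:R) pi_gj.
  have := gj_le1 (y / q%:R) gj1.
  by have := pi0 (y / q%:R); have := pi10 (y / q%:R); rewrite /Phi; lra.
have Phi_additive y z : defect P y z = 0 -> defect Phi y z = 0.
  rewrite /defect /P /Phi mulrDl; have := pi1_sub (y / q%:R) (z / q%:R).
  have := pi2_sub (y / q%:R) (z / q%:R).
  have := piEr (y / q%:R); have := piEr (z / q%:R).
  have := piEr (y / q%:R + z / q%:R).
  by lra.
have Phi_int k : Phi k%:~R = 0.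
  have := congr1 (@^~ (grid_point N (k * 4))) rE; rewrite /= /Phi.
  have -> : (k * 4)%:~R / N%:R = k%:~R / q%:R :> R.
    by rewrite /N natrM intrM -[4%:~R]/(4%:R); field.
  by move=> ->; rewrite subrr.
have quarterE i : quarter i / q%:R = i%:~R / N%:R :> R.
  by rewrite /quarter /N natrM; field.
pose F (i : int) := pi (i%:~R / N%:R).
have F_gj : gj_conditions (multiples N) (fq * 4) F.
  have := gj_pullback (@grid_pointD R N) (@integers_grid_point R N N0)
    (erefl _) (r_gj _ pi_gj).
  exact.
pose w := zigzag Phi.
have w_add i j : F i + F j = F (i + j) -> w i + w j = w (i + j).
  move=> Fij; apply: (zigzag_additive (P := P) (M := 1)) => //.
  by rewrite /defect -quarterD /P !quarterE -/(F _) -/(F _) -/(F _) Fij subrr.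
have w_mult m : w (m * N%:Z) = 0.
  by rewrite /w (_ : m * N%:Z = (m * q%:Z) * 4) ?zigzag_mul4 // /N PoszM; ring.
have [eps eps0 perturb] :=
  perturbation_gj N0 F_gj w_add w_mult (zigzag_mul4 _ _).
have perturb_valid c : `|c| <= eps -> valid_function (@integers_in_fracZ R N)
    (grid_point N (fq * 4)) (fun r => F (numerator r) + c * w (numerator r)).
  move=> /perturb c_gj; apply: gj_valid => //.
  exact: (gj_pullback (numeratorD N0) (multiples_numerator N0)
    (grid_pointK N0 _) c_gj).
have FE (r : fracZ R N) : F (numerator r) = pi (fracZ_val r).
  by rewrite -{2}(numeratorK N0 r).
have [|||e _] := r_ext _ _ (perturb_valid eps _) (perturb_valid (- eps) _).
- by rewrite gtr0_norm.
- by rewrite normrN gtr0_norm.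
- by apply/funext => r; rewrite -FE; lra.
have [i wi] := zigzag_neq0 Phix; have := congr1 (@^~ (grid_point N i)) e.
rewrite /= grid_pointK // -/(F i) => /eqP.
rewrite eq_sym -subr_eq0 addrAC subrr add0r.
by rewrite mulf_eq0 (negPf wi) gt_eqF.
Qed.

Unset Implicit Arguments.

Theorem theorem1p5 (R : realType) (f : R) (pi : R -> R)
    (n : nat) (x : 'I_n.+1 -> rat) (q : nat) :
  subdivision01 x ->
  q = least_common_denominator x ->
  continuous pi ->
  piecewise_linear (breakpoints (fun i => ratr (x i) : R)) pi ->
  minimal_valid (@integers R) f pi ->
  exists2 fhat : fracZ R (4 * q), fracZ_val fhat = f &
    extreme (@integers R) f pi <->
    extreme (@integers_in_fracZ R (4 * q)) fhat
      (fun r : fracZ R (4 * q) => pi (fracZ_val r)).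
Proof.
move=> x_sub qE pi_cont pi_lin pi_min.
have q0 : (0 < q)%N by rewrite qE least_common_denominator_gt0.
have pi_gj := minimal_gj integers0 integersB pi_min.
have pi_aff N : (0 < N)%N -> (q %| N)%N ->
    integer_affine (fun y => pi (y / N%:R)).
  move=> N0 qN; apply: piecewise_linear_integer_affine pi_lin => //.
    exact: subdivision01_ratr.
  by move=> i; apply: integer_multiple_denominator; rewrite -?qE.
have [fq fE] := gj_target_on_grid q0 pi_gj (pi_aff q q0 (dvdnn q)).
have N0 : (0 < 4 * q)%N by rewrite muln_gt0.
have fN : f = (fq * 4)%:~R / (4 * q)%:R.
  by rewrite fE natrM intrM -[4%:~R]/(4%:R); field; rewrite pnatr_eq0 -lt0n.
exists (grid_point (4 * q) (fq * 4)); first by rewrite fN.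
split; last exact: extreme_from_restriction q0 fE pi_gj (pi_aff q q0 (dvdnn q)).
by apply: extreme_restriction => //; apply: pi_aff => //; exact: dvdn_mull.
Qed.
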